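(* Let $(G,\omega)$ be a connected decorated planar graph with $\omega$ a characteristic weight. If $\xi\in\mathrm{BMS}(G,\omega)$, then the lattice of plus-subobjects of $\xi$ is isomorphic to the lattice of subrepresentations of the quiver representation $\mathcal{M}(\xi)$.
   Context: **Planar graphs.** $G=(V_G,E_G)$ is a finite connected undirected multigraph (multiple edges allowed) without loops, with every vertex of degree $\ge 2$, embedded in the oriented sphere $S^2$; $F_G$ is its set of faces. An angle at a vertex $v$ is a pair of half-edges at $v$ that are consecutive in the clockwise cyclic order around $v$; it is oriented clockwise, from its source edge $s(a)$ to its target edge $t(a)$ (the next edge clockwise), and lies in one face. $A_G$ is the set of angles; $A_G(v)$, $A_G(f)$ are those at a vertex $v$, resp. in a face $f$. The directed medial graph (a quiver without loops) $\mathcal{Q}G$ has vertex set $E_G$ and one arrow $s(a)\to t(a)$ for each $a\in A_G$; for $x\in V_G\sqcup F_G$ the arrows $A_G(x)$ form an oriented cycle $\mathcal{Q}G(x)$. **Weights.** A weight is a class $\omega\in H^1(|\mathcal{Q}G|;\mathbb{Z})$ admitting compatible functions, equivalently a function $\omega\colon V_G\sqcup F_G\to\mathbb{Z}_{\ge0}$ with $\sum_{v}\omega(v)=\sum_f\omega(f)$ ($\omega(x)$ being the value of the class on $\mathcal{Q}G(x)$). It is characteristic if this function takes values in $\{0,1\}$. An angular function $g\colon A_G\to\mathbb{Z}_{\ge0}$ is $\omega$-compatible if it represents $\omega$ as a cellular 1-cochain, equivalently $\sum_{a\in A_G(x)}g(a)=\omega(x)$ for all $x\in V_G\sqcup F_G$.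 $\mathcal{L}(G,\omega)$ is the set of these. For $\epsilon\colon E_G\to\mathbb{Z}$ let $(\delta\epsilon)(a)=\epsilon(t(a))-\epsilon(s(a))$; $\chi_e$ is the characteristic function of $e\in E_G$; $g\in\mathcal{L}(G,\omega)$ is $e$-movable if $g+\delta\chi_e\ge0$. **BMS states.** An angular cycle is a cellular 1-cycle $c=\sum_a c_a a$ of $|\mathcal{Q}G|$ with all $c_a\ge0$; it is invisible if $c\neq0$ and $\omega$ takes value $0$ on it, and connected if the arrows with $c_a\ne0$ form a connected subgraph. A BMS state for $(G,\omega)$ is a triple $(f_+,f_-,d)$ with $f_\pm\in\mathcal{L}(G,\omega)$ and $d\colon E_G\to\mathbb{Z}_{\ge0}$ such that $f_+=f_-+\delta d$, and $d(e)=0$ for every edge $e$ belonging to a connected invisible angular cycle. $\mathrm{BMS}(G,\omega)$ is the directed graph whose vertices are the BMS states, with an edge from $(f_+,f_-,d)$ to $\mathrm{mov}_e(f_+,f_-,d)=(f_++\delta\chi_e,f_-,d+\chi_e)$ for each $e\in E_G$ such that $f_+$ is $e$-movable. It is a poset under $\xi'\le\xi$ iff there is a directed path from $\xi'$ to $\xi$. A plus-subobject of $\xi$ is a BMS state $\xi'$ with $\xi'\le\xi$; the plus-subobjects are ordered by $\le$. **The representation $\mathcal{M}(\xi)$** of the quiver $\mathcal{Q}G$ over $\mathbb{C}$, for $\xi=(f_+,f_-,d)$: $\mathcal{M}(\xi)_e=\mathbb{C}^{d(e)}$ for $e\in E_G$. For an arrow $a$: if $f_-(a)\le d(s(a))$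 and $f_+(a)\le d(t(a))$, put $r=d(s(a))-f_-(a)=d(t(a))-f_+(a)\ge0$ and let $\mathcal{M}(\xi)_a\colon\mathbb{C}^{d(s(a))}\to\mathbb{C}^{d(t(a))}$ be the matrix $\begin{pmatrix}0_{r\times f_-(a)}&\mathbb{1}_r\\0_{f_+(a)\times f_-(a)}&0_{f_+(a)\times r}\end{pmatrix}$; otherwise $\mathcal{M}(\xi)_a=0$. Subrepresentations are ordered by inclusion. *)

(* Defs.v *)
From HB Require Import structures.
From Stdlib Require Import Relation_Operators.
From mathcomp Require Import all_boot all_order all_algebra.
From mathcomp Require Import perm reals.
From mathcomp.real_closed Require Import complex.

Set Implicit Arguments.
Unset Strict Implicit.
Unset Printing Implicit Defensive.

Import Order.TTheory GRing.Theory Num.Theory.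
Local Open Scope ring_scope.

(* A multigraph cellularly embedded in a closed oriented surface, given by its
   rotation system.  The two half-edges of [e] are [(e, false)] and [(e, true)]
   (the labelling is an arbitrary orientation of [e]), [endpoint h] is the
   vertex at which [h] is attached, and [cw h] is the half-edge which follows
   [h] in the clockwise order around that vertex. *)
Record embedded_graph := EmbeddedGraph {
  vertex : finType;
  edge : finType;
  endpoint : edge * bool -> vertex;
  cw : {perm edge * bool};
  cw_orbit : forall h h', fconnect cw h h' = (endpoint h == endpoint h')
}.

(* The angle (h, cw h) is identified with its source half-edge h; when the
   degree is 2, the two angles (h, h') and (h', h) are distinct. *)
Definition angle (G : embedded_graph) : finType := (edge G * bool)%type.

Section EmbeddedGraph.
Variable G : embedded_graph.
Implicit Types (a b h : angle G) (u v : vertex G) (e : edge G).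

Definition opposite h : angle G := (h.1, ~~ h.2).

Definition src a : edge G := a.1.
Definition tgt a : edge G := (cw G a).1.

(* The face containing the angle (h, cw h) lies on the clockwise side of h, and
   on the counterclockwise side of cw h.  Seen from the other end of the edge
   of cw h, it lies on the clockwise side of opposite (cw h), which is thus the
   source half-edge of the next angle of that face. *)
Definition face_next a : angle G := opposite (cw G a).

Definition face : finType :=
  {f : {set angle G} | f \in [set [set b | fconnect face_next a b] | a : angle G]}.

Definition angles_at (x : vertex G + face) : {set angle G} :=
  match x with
  | inl v => [set a | endpoint a == v]
  | inr f => val f
  end.

Definition adjacent : rel (vertex G) :=
  fun u v => [exists h, (endpoint h == u) && (endpoint (opposite h) == v)].

Definition connected_graph := forall u v, connect adjacent u v.

Definition loopless := forall h, endpoint h != endpoint (opposite h).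

Definition min_degree2 := forall v, (2 <= #|[set h : angle G | endpoint h == v]|)%N.

(* By Euler's formula, the surface underlying a connected rotation system is a
   sphere iff |V| - |E| + |F| = 2. *)
Definition spherical := (#|vertex G| + #|face| = #|edge G| + 2)%N.

End EmbeddedGraph.

Record planar_graph := PlanarGraph {
  planar_embedding :> embedded_graph;
  planar_connected : connected_graph planar_embedding;
  planar_loopless : loopless planar_embedding;
  planar_degree : min_degree2 planar_embedding;
  planar_sphere : spherical planar_embedding
}.

Section Weights.
Variable G : planar_graph.
Implicit Types (a : angle G) (e : edge G) (w : angle G -> int).

Definition coboundary (eps : edge G -> int) a : int := eps (tgt a) - eps (src a).

Definition chi e : edge G -> int := fun e' => (e' == e)%:R.

(* [g] represents the class of the cochain [w] in H^1(|QG|; Z). *)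
Definition represents w (g : {ffun angle G -> nat}) : Prop :=
  exists eps : edge G -> int, forall a, (g a)%:Z = w a + coboundary eps a.

(* A weight is a class in H^1(|QG|; Z), given by an arbitrary cochain [cochain]
   in that class.  All the notions below depend only on the class, see
   [eval_coboundary] and [angles_at_cycle]. *)
Record weight := Weight {
  cochain :> angle G -> int;
  weight_compatible : exists g : {ffun angle G -> nat}, represents cochain g
}.

Implicit Type omega : weight.

Definition compatible omega (g : {ffun angle G -> nat}) : Prop :=
  represents omega g.

Definition weight_at omega (x : vertex G + face G) : int :=
  \sum_(a in angles_at x) omega a.

Definition characteristic omega : Prop :=
  forall x, weight_at omega x = 0 \/ weight_at omega x = 1.

Definition movable (g : {ffun angle G -> nat}) e : Prop :=
  forall a, 0 <= (g a)%:Z + coboundary (chi e) a.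

Definition angular_cycle (c : angle G -> nat) : Prop :=
  forall e, (\sum_(a | tgt a == e) c a = \sum_(a | src a == e) c a)%N.

Definition eval w (c : angle G -> nat) : int := \sum_a w a * (c a)%:Z.

Definition invisible omega (c : angle G -> nat) : Prop :=
  (exists a, c a <> 0%N) /\ eval omega c = 0.

Definition supp_adjacent (c : angle G -> nat) : rel (edge G) :=
  fun e e' => [exists a, (c a != 0%N) &&
    (((src a == e) && (tgt a == e')) || ((src a == e') && (tgt a == e)))].

Definition connected_chain (c : angle G -> nat) : Prop :=
  forall a b, c a <> 0%N -> c b <> 0%N ->
    connect (supp_adjacent c) (src a) (src b).

Definition belongs e (c : angle G -> nat) : Prop :=
  exists2 a, c a <> 0%N & e = src a \/ e = tgt a.

Lemma eval_coboundary (eps : edge G -> int) (c : angle G -> nat) :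
  angular_cycle c -> eval (coboundary eps) c = 0.
Proof.
move=> cyc; rewrite /eval /coboundary.
under eq_bigr do rewrite mulrBl.
rewrite sumrB (partition_big (@tgt G) predT) //=.
rewrite [X in _ - X](partition_big (@src G) predT) //=.
apply/eqP; rewrite subr_eq0; apply/eqP/eq_bigr => e _.
transitivity (eps e * (\sum_(a | tgt a == e) c a)%:Z).
  rewrite (big_morph Posz PoszD erefl) mulr_sumr.
  by apply: eq_bigr => a /eqP ->.
rewrite cyc (big_morph Posz PoszD erefl) mulr_sumr.
by apply: eq_bigr => a /eqP ->.
Qed.

Lemma opposite_inj : injective (@opposite G).
Proof. by move=> [e b] [e' b'] [-> /negb_inj ->]. Qed.

Lemma angles_at_cycle (x : vertex G + face G) :
  angular_cycle (fun a => (a \in angles_at x) : nat).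
Proof.
move=> e; case: x => [v|[f hf]] /=.
  rewrite [RHS](reindex_inj (@perm_inj _ (cw G))) /=.
  apply: eq_bigr => a _; rewrite !inE.
  by have /eqP -> := etrans (esym (cw_orbit a (cw G a))) (fconnect1 _ _).
have finj : injective (@face_next G).
  by move=> a b /opposite_inj /perm_inj.
rewrite [RHS](reindex_inj finj) /=.
apply: eq_bigr => a _; case/imsetP: hf => b _ ->; rewrite !inE.
by rewrite (same_connect_r (fconnect_sym finj) (fconnect1 _ a)).
Qed.

End Weights.

Section BMS.
Variables (G : planar_graph) (omega : weight G).

Record bms := BMS {
  fplus : {ffun angle G -> nat};
  fminus : {ffun angle G -> nat};
  dd : {ffun edge G -> nat};
  fplus_compatible : compatible omega fplus;
  fminus_compatible : compatible omega fminus;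
  bms_diff : forall a,
    (fplus a)%:Z = (fminus a)%:Z + coboundary (fun e => (dd e)%:Z) a;
  bms_invisible : forall (e : edge G) (c : angle G -> nat),
    angular_cycle c -> invisible omega c -> connected_chain c -> belongs e c ->
    dd e = 0%N
}.

(* [bms_move e xi xi'] holds iff there is an edge from xi to xi' = mov_e xi. *)
Definition bms_move (e : edge G) (xi xi' : bms) : Prop :=
  [/\ movable (fplus xi) e,
      forall a, (fplus xi' a)%:Z = (fplus xi a)%:Z + coboundary (chi e) a,
      fminus xi' = fminus xi
    & forall e', dd xi' e' = (dd xi e' + (e' == e))%N].

Definition bms_le : bms -> bms -> Prop :=
  clos_refl_trans bms (fun xi xi' => exists e, bms_move e xi xi').

Definition plus_subobject (xi : bms) : Type := {xi' : bms | bms_le xi' xi}.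

Definition plus_subobject_le (xi : bms) (x y : plus_subobject xi) : Prop :=
  bms_le (sval x) (sval y).

End BMS.

(* Representations act on column vectors. *)
Record representation (K : fieldType) (G : planar_graph) := Representation {
  rep_dim : edge G -> nat;
  rep_map : forall a : angle G, 'M[K]_(rep_dim (tgt a), rep_dim (src a))
}.

Record subrepresentation (K : fieldType) (G : planar_graph)
    (M : representation K G) := Subrepresentation {
  subspace : forall e : edge G, {vspace 'cV[K]_(rep_dim M e)};
  subspace_stable : forall (a : angle G) (v : 'cV[K]_(rep_dim M (src a))),
    v \in subspace (src a) -> rep_map M a *m v \in subspace (tgt a)
}.

Definition subrepresentation_le (K : fieldType) (G : planar_graph)
    (M : representation K G) (U W : subrepresentation M) : Prop :=
  forall e, (subspace U e <= subspace W e)%VS.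

(* The first r rows of the matrix of the arrow [a] are (0_{r x f_-(a)} | 1_r),
   where r = d(s(a)) - f_-(a) = d(t(a)) - f_+(a); the last f_+(a) rows vanish. *)
Definition bms_rep (R : realType) (G : planar_graph) (omega : weight G)
    (xi : bms omega) : representation R[i] G :=
  @Representation R[i] G (dd xi) (fun a =>
    if (fminus xi a <= dd xi (src a))%N && (fplus xi a <= dd xi (tgt a))%N then
      \matrix_(i < dd xi (tgt a), j < dd xi (src a))
        ((i < dd xi (src a) - fminus xi a)%N &&
         (j == fminus xi a + i :> nat)%N)%:R
    else 0).

Section Lattice.
Variables (T : Type) (le : T -> T -> Prop).

Definition is_meet x y m :=
  [/\ le m x, le m y & forall z, le z x -> le z y -> le z m].

Definition is_join x y j :=
  [/\ le x j, le y j & forall z, le x z -> le y z -> le j z].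

Definition is_lattice : Prop :=
  [/\ forall x, le x x,
      forall x y z, le x y -> le y z -> le x z,
      forall x y, le x y -> le y x -> x = y,
      forall x y, exists m, is_meet x y m
    & forall x y, exists j, is_join x y j].

End Lattice.

Definition isomorphic_lattices (T1 T2 : Type) (le1 : T1 -> T1 -> Prop)
    (le2 : T2 -> T2 -> Prop) : Prop :=
  [/\ is_lattice le1, is_lattice le2
    & exists2 phi : T1 -> T2, bijective phi
        & forall x y, le1 x y <-> le2 (phi x) (phi y)].

(* Main.v *)
(* A plus-subobject of xi = (f_+, f_-, d) amounts to a function d' <= d with
   f_- + delta d' >= 0: if no edge with d' < d is movable, following outgoing
   angles on which f' = f_- + delta d' vanishes yields an invisible cycle
   through an edge with d > 0, so d' can always be raised one edge at a time up
   to d.  On the side of representations, the arrow a maps the j-th basis vector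
   to the (j - f_-(a))-th one (or to 0).  If d(e) > 0, the end v of e has weight
   1, since otherwise its angles would form an invisible cycle, so the turn
   around v acts on C^d(e) as one nilpotent Jordan block, whose invariant
   subspaces are spanned by initial segments of the basis.  The dimensions d' of
   such subspaces define a subrepresentation iff f_- + delta d' >= 0. *)
From Stdlib Require Import Relation_Operators.
Require Import Defs.
From mathcomp Require Import all_boot all_order all_algebra.
From mathcomp Require Import perm reals zify boolp complex.

Set Implicit Arguments.
Unset Strict Implicit.
Unset Printing Implicit Defensive.

Import Order.TTheory GRing.Theory Num.Theory.
Local Open Scope ring_scope.

(** * Directed cycles in the medial quiver *)

Lemma periodic_point (T : finType) (f : T -> T) (x : T) :
  exists2 y, fconnect f x y & iter (order f y) f y = y.
Proof.
have /trajectP[i lt_i eq_i] := looping_order f x.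
exists (iter i f x); first exact: fconnect_iter.
(* The point [iter i f x] recurs after [order f x - i > 0] steps; the clause used asks for a period
   of the form [k.+1], whence the predecessor. *)
apply/(orbitPcycle 3 4); exists (order f x - i).-1.
by rewrite prednK ?subn_gt0 // -iterD subnK ?eq_i // ltnW.
Qed.

Section Cycles.
Variable G : planar_graph.

Lemma supp_adjacent_sym (c : angle G -> nat) : symmetric (supp_adjacent c).
Proof.
by move=> e e'; apply/existsP/existsP => -[a Ha]; exists a; rewrite orbC.
Qed.

(** One chosen outgoing angle per edge gives a self-map of the finite set of edges. Iterating it
    from [e0] ends in a periodic orbit, and the chosen angles along that orbit form a simple
    cycle. *)
Lemma selection_cycle (nxt : edge G -> angle G) (e0 : edge G) :
    (forall e, src (nxt e) = e) ->
  exists e, exists c : angle G -> nat,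
  [/\ angular_cycle c, connected_chain c, c (nxt e) <> 0%N
    & forall a, c a <> 0%N ->
        a = nxt (src a) /\ fconnect (fun x => tgt (nxt x)) e0 (src a)].
Proof.
move=> nxtK; pose f e := tgt (nxt e).
have [y e0y per_y] := periodic_point f e0.
pose O := orbit f y.
have injO : {in O &, injective f} by apply/(orbitPcycle 4 5).
have fO x : x \in O -> f x \in O.
  by rewrite /O -!fconnect_orbit => yx; apply: connect_trans yx (fconnect1 _ _).
(* On a periodic orbit [f] is onto; the base point [y] is preceded by the last point of the
   orbit. *)
have preO x : x \in O -> exists2 z, z \in O & f z = x.
  rewrite /O -fconnect_orbit => yx.
  case: (posnP (findex f y x)) => [f0|f_gt0].
    have xy : x = y by rewrite -(iter_findex yx) f0.
    exists (iter (order f y).-1 f y).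
      by rewrite -fconnect_orbit fconnect_iter.
    by rewrite -iterS prednK ?order_gt0 // xy.
  exists (iter (findex f y x).-1 f y).
    by rewrite -fconnect_orbit fconnect_iter.
  by rewrite -iterS prednK // iter_findex.
pose c (a : angle G) : nat := (a == nxt (src a)) && (src a \in O).
have cP a : c a <> 0%N -> a = nxt (src a) /\ src a \in O.
  by rewrite /c; case: eqP; case: (_ \in O).
have cnxt e : e \in O -> c (nxt e) = 1%N by rewrite /c nxtK eqxx => ->.
exists y, c; split.
- move=> e; have [eO|eO] := boolP (e \in O).
    have [z zO fz] := preO _ eO.
    rewrite (bigD1 (nxt z)) /=; last exact/eqP.
    rewrite [RHS](bigD1 (nxt e)) /= ?nxtK // !cnxt // !big1 //.
      move=> b /andP[/eqP sb nb]; apply/eqP; apply: contraNT nb => /eqP cb.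
      by have [-> _] := cP _ cb; rewrite sb.
    move=> b /andP[/eqP sb nb]; apply/eqP; apply: contraNT nb => /eqP cb.
    have [bE bO] := cP _ cb; rewrite bE.
    by rewrite (injO (src b) z) // fz /f -bE.
  rewrite !big1 // => b /eqP sb; apply/eqP; apply: contraNT eO => /eqP cb;
    have [bE bO] := cP _ cb.
    by rewrite -sb.
  by rewrite -sb bE; exact: fO.
- have conn e : e \in O -> connect (supp_adjacent c) y e.
    rewrite -fconnect_orbit => ye; rewrite -(iter_findex ye).
    elim: (findex _ _ _) => //= n IH; apply: connect_trans IH (connect1 _).
    apply/existsP; exists (nxt (iter n f y)).
    by rewrite nxtK !eqxx cnxt // -fconnect_orbit fconnect_iter.
  move=> a b /cP[_ aO] /cP[_ bO].
  apply: connect_trans (conn _ bO).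
  by rewrite (sym_connect_sym (@supp_adjacent_sym c)) conn.
- by rewrite cnxt // -fconnect_orbit connect0.
- move=> a /cP[aE aO]; split=> //; apply: connect_trans e0y _.
  by rewrite fconnect_orbit.
Qed.

(** The angles [h] and [cw h] share the edge of [cw h], so the rotation around [v] links all angles
    at [v]. *)
Lemma connected_vertex (v : vertex G) :
  connected_chain (fun a : angle G => (a \in angles_at (inl v)) : nat).
Proof.
move=> a b; rewrite !inE.
case: eqP => // av _; case: eqP => // bv _.
have ab : fconnect (cw G) a b by rewrite cw_orbit av bv.
rewrite -(iter_findex ab); elim: (findex _ _ _) => //= n IH.
apply: connect_trans IH (connect1 _); apply/existsP; exists (iter n (cw G) a).
rewrite inE; have /eqP <- : endpoint a == endpoint (iter n (cw G) a).
  by rewrite -cw_orbit fconnect_iter.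
by rewrite av !eqxx.
Qed.

(** Representatives of one class differ by a coboundary, which vanishes on cycles. *)
Lemma eval_compatible (omega : weight G) g (c : angle G -> nat) :
  compatible omega g -> angular_cycle c ->
  eval (fun a => (g a)%:Z) c = eval omega c.
Proof.
move=> [eps gE] cyc; rewrite -[RHS]addr0 -(eval_coboundary eps cyc) /eval.
by rewrite -big_split; apply: eq_bigr => a _; rewrite gE mulrDl.
Qed.

End Cycles.

(** * States below a given state *)

Section States.
Variables (G : planar_graph) (omega : weight G).
Implicit Types (xi zeta : bms omega) (a : angle G) (e : edge G).

Lemma fplusE xi a :
  (fplus xi a + dd xi (src a) = fminus xi a + dd xi (tgt a))%N.
Proof. by have := bms_diff xi a; rewrite /coboundary; lia. Qed.

Lemma bms_ext xi zeta : fminus xi = fminus zeta -> dd xi = dd zeta -> xi = zeta.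
Proof.
move=> eqm eqd; have eqp : fplus xi = fplus zeta.
  by apply/ffunP => a; have := fplusE xi a; have := fplusE zeta a; rewrite eqm eqd; lia.
case: xi zeta eqm eqd eqp => p m d ? ? ? ? [p' m' d' ? ? ? ?] /= eqm eqd eqp.
by subst; congr BMS; exact: Prop_irrelevance.
Qed.

(** The second hypothesis says that [f_- + delta d] is nonnegative, so it can serve as [f_+], in the
    same class. The vanishing of [d] on invisible cycles is inherited from [dd xi]. *)
Lemma bms_below xi (d : {ffun edge G -> nat}) :
    (forall e, d e <= dd xi e)%N ->
    (forall a, d (src a) <= fminus xi a + d (tgt a))%N ->
  exists2 zeta : bms omega, fminus zeta = fminus xi & dd zeta = d.
Proof.
move=> d_le d_ok.
pose p : {ffun angle G -> nat} :=
  [ffun a => (fminus xi a + d (tgt a) - d (src a))%N].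
have pE a : (p a)%:Z = (fminus xi a)%:Z + coboundary (fun e => (d e)%:Z) a.
  by rewrite ffunE /coboundary; have := d_ok a; lia.
have p_comp : compatible omega p.
  have [eps epsE] := fminus_compatible xi.
  exists (fun e => eps e + (d e)%:Z) => a.
  by rewrite pE epsE /coboundary; lia.
suff inv e c : angular_cycle c -> invisible omega c -> connected_chain c ->
    belongs e c -> d e = 0%N.
  by exists (BMS p_comp (fminus_compatible xi) pE inv).
move=> c1 c2 c3 c4; have := bms_invisible xi c1 c2 c3 c4.
by have := d_le e; lia.
Qed.

Lemma bms_le_fminus xi zeta : bms_le zeta xi -> fminus zeta = fminus xi.
Proof. by elim=> [x y [e []]|x|x y z _ -> _ ->]. Qed.

Lemma bms_le_dd xi zeta : bms_le zeta xi -> forall e, (dd zeta e <= dd xi e)%N.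
Proof.
elim=> [x y [e [_ _ _ ddE]] e'|x e|x y z _ xy _ yz e].
- by rewrite ddE leq_addr.
- exact: leqnn.
- exact: leq_trans (xy e) (yz e).
Qed.

Lemma movable_below xi zeta e0 :
    fminus zeta = fminus xi -> (forall e, dd zeta e <= dd xi e)%N ->
    (dd zeta e0 < dd xi e0)%N ->
  exists2 e, (dd zeta e < dd xi e)%N & movable (fplus zeta) e.
Proof.
move=> eqm le_d lt_e0; apply: contrapT => stuck.
(* These are the angles that obstruct moving [e]: an angle from [e] to itself would not feel the
   move. *)
pose bad e a := (src a == e) && (tgt a != e) && (fplus zeta a == 0%N).
(* The default also starts at [e], so that [nxtK] holds for every edge. *)
pose nxt e := odflt (e, false) [pick a | bad e a].
have nxtK e : src (nxt e) = e.
  by rewrite /nxt; case: pickP => //= a /andP[/andP[/eqP]].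
have nxt_bad e : (dd zeta e < dd xi e)%N -> bad e (nxt e).
  move=> lt_e; rewrite /nxt; case: pickP => //= no_bad.
  case: stuck; exists e => // a; rewrite /coboundary /chi.
  have := no_bad a; rewrite /bad.
  by case: (src a == e); case: (tgt a == e) => //=; lia.
(* The coboundary of [dd xi - dd zeta] is [fplus xi - fplus zeta], hence nonnegative where
   [fplus zeta] vanishes: the gap cannot shrink along such an angle. *)
have nxt_lt e : (dd zeta e < dd xi e)%N ->
    (dd zeta (tgt (nxt e)) < dd xi (tgt (nxt e)))%N.
  move=> lt_e; have /andP[_ /eqP p0] := nxt_bad _ lt_e.
  by have := fplusE zeta (nxt e); have := fplusE xi (nxt e);
    rewrite eqm nxtK p0; lia.
have [e [c [cyc conn ce cP]]] := selection_cycle e0 nxtK.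
have c_lt a : c a <> 0%N -> (dd zeta (src a) < dd xi (src a))%N.
  move=> /cP[_ con]; rewrite -(iter_findex con).
  by elim: (findex _ _ _) => //= n; exact: nxt_lt.
have inv : invisible omega c.
  split; first by exists (nxt e).
  rewrite -(eval_compatible (fplus_compatible zeta) cyc) /eval big1 // => a _.
  have [->|/eqP ca] := eqVneq (c a) 0%N; first by rewrite mulr0.
  have [aE _] := cP _ ca.
  by have := nxt_bad _ (c_lt _ ca); rewrite -aE => /andP[_ /eqP ->]; rewrite mul0r.
(* The cycle is invisible, so [dd xi] vanishes on it, which leaves no room for a gap. *)
have := c_lt _ ce.
by rewrite (bms_invisible xi cyc inv conn) //; exists (nxt e); last left.
Qed.

(** Induction on the total gap between [dd zeta] and [dd xi]: [movable_below] supplies an edge whose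
    move lowers it by one. Hence the order is the pointwise comparison of [d] at fixed [f_-]. *)
Lemma bms_leP xi zeta : fminus zeta = fminus xi ->
  (forall e, dd zeta e <= dd xi e)%N -> bms_le zeta xi.
Proof.
have [n] := ubnP (\sum_e (dd xi e - dd zeta e))%N.
elim: n zeta => // n IH zeta lt_n eqm le_d.
case: (pickP (fun e => dd zeta e != dd xi e)) => [e0 ne0|eqd]; last first.
  rewrite (@bms_ext xi zeta) //; first exact: rt_refl.
  by apply/ffunP => e; have /negbFE/eqP := eqd e.
have lt_e0 : (dd zeta e0 < dd xi e0)%N by rewrite ltn_neqAle ne0 le_d.
have [e lt_e mov_e] := movable_below eqm le_d lt_e0.
pose d' : {ffun edge G -> nat} := [ffun e' => (dd zeta e' + (e' == e))%N].
have d'_le e' : (d' e' <= dd xi e')%N.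
  by rewrite ffunE; case: eqP => [->|_]; rewrite ?addn1 ?addn0.
have d'_ok a : (d' (src a) <= fminus xi a + d' (tgt a))%N.
  have := mov_e a; rewrite -eqm !ffunE /coboundary /chi.
  by have := fplusE zeta a; lia.
have [zeta' eqm' eqd'] := bms_below d'_le d'_ok.
apply: (rt_trans _ _ _ zeta'); last first.
  apply: IH => //; last by move=> e'; rewrite eqd'.
  move: lt_n; rewrite ltnS; apply: leq_trans.
  rewrite [X in (_ < X)%N](bigD1 e) //= (bigD1 e) //=.
  rewrite -addSn leq_add //; first by rewrite eqd' ffunE eqxx; lia.
  by apply: leq_sum => e' _; rewrite eqd' ffunE; lia.
apply: rt_step; exists e; split=> //.
- move=> a; have := fplusE zeta a; have := fplusE zeta' a.
  by rewrite eqm' eqm eqd' !ffunE /coboundary /chi; lia.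
- by rewrite eqm' eqm.
- by move=> e'; rewrite eqd' ffunE.
Qed.

End States.

(** * Invariant flags of a nilpotent Jordan block *)

Section Flags.
Variable K : fieldType.

(* The [i]-th coordinate of [v], extended by 0 beyond [n]. *)
Definition coordn n (v : 'cV[K]_n) (i : nat) : K :=
  \sum_(j < n) (j == i :> nat)%:R * v j 0.

Lemma coordn_ord n (v : 'cV[K]_n) (i : 'I_n) : coordn v i = v i 0.
Proof.
rewrite /coordn (bigD1 i) //= eqxx mul1r big1 ?addr0 // => j /negPf ji.
by rewrite (inj_eq val_inj) ji mul0r.
Qed.

Lemma coordn_out n (v : 'cV[K]_n) i : (n <= i)%N -> coordn v i = 0.
Proof.
move=> le_n; rewrite /coordn big1 // => j _.
by rewrite ltn_eqF ?mul0r // (leq_trans (ltn_ord j)).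
Qed.

Lemma coordn_lin n a (v w : 'cV[K]_n) i :
  coordn (v - a *: w) i = coordn v i - a * coordn w i.
Proof.
rewrite /coordn mulr_sumr -sumrB; apply: eq_bigr => j _.
by rewrite !mxE mulrBr mulrCA.
Qed.

Lemma coordn_inj n (v w : 'cV[K]_n) : coordn v =1 coordn w -> v = w.
Proof. by move=> vw; apply/colP => i; rewrite -!coordn_ord vw. Qed.

Lemma coordn_delta n (j : 'I_n) i :
  coordn (delta_mx j 0 : 'cV[K]_n) i = (j == i :> nat)%:R.
Proof.
rewrite /coordn (bigD1 j) //= mxE !eqxx mulr1 big1 ?addr0 // => k /negPf kj.
by rewrite mxE kj mulr0.
Qed.

(** The span of the first [k] basis vectors, as the kernel of the projection onto the coordinates
    from [k] on; the whole space once [k >= n]. *)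
Definition flag n k : {vspace 'cV[K]_n} :=
  lker (linfun (mulmx (\matrix_(i < n, j < n) ((i == j) && (k <= i)%N)%:R))).

Lemma flagP n k (v : 'cV[K]_n) :
  reflect (forall i, (k <= i)%N -> coordn v i = 0) (v \in flag n k).
Proof.
have mulE (i : 'I_n) :
    ((\matrix_(i < n, j < n) ((i == j) && (k <= i)%N)%:R) *m v) i 0
      = (k <= i)%N%:R * v i 0.
  rewrite mxE (bigD1 i) //= mxE eqxx big1 ?addr0 // => j /negPf ji.
  by rewrite mxE eq_sym ji mul0r.
rewrite memv_ker lfunE /=; apply: (iffP eqP) => [v0 i le_k|v0].
  case: (ltnP i n) => [lt_n|]; last exact: coordn_out.
  have := congr1 (fun w : 'cV_n => w (Ordinal lt_n) 0) v0.
  by rewrite mulE mxE /= le_k mul1r -coordn_ord.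
apply/colP => i; rewrite mulE mxE; case: leqP => [le_k|]; last by rewrite mul0r.
by rewrite mul1r -coordn_ord v0.
Qed.

Lemma flag_leP n k l : (k <= n)%N -> reflect (k <= l)%N (flag n k <= flag n l)%VS.
Proof.
move=> le_n; apply: (iffP subvP) => [sub|le_kl v /flagP v0]; last first.
  by apply/flagP => i le_l; apply: v0; apply: leq_trans le_kl le_l.
(* If [l < k <= n], the basis vector of index [l] separates the two flags. *)
case: leqP => // lt_l; pose j := Ordinal (leq_trans lt_l le_n).
have /sub/flagP/(_ l (leqnn l)) : delta_mx j 0 \in flag n k.
  apply/flagP => i le_k; rewrite coordn_delta /= ltn_eqF //.
  exact: leq_trans le_k.
by rewrite coordn_delta eqxx => /eqP; rewrite oner_eq0.
Qed.

(** Invariance under the Jordan block that lowers the index of each basis vector by one; on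
    coordinates, it can be read off a composite of arrows without naming a matrix. *)
Definition shift_closed n (U : {vspace 'cV[K]_n}) : Prop :=
  forall v, v \in U -> exists2 w, w \in U & forall i, coordn w i = coordn v i.+1.

Lemma shift_closed_iter n (U : {vspace 'cV[K]_n}) m v :
    shift_closed U -> v \in U ->
  exists2 w, w \in U & forall i, coordn w i = coordn v (m + i).
Proof.
move=> shU vU; elim: m => [|m [w wU wE]]; first by exists v.
have [w' w'U w'E] := shU _ wU; exists w' => // i.
by rewrite w'E wE addnS.
Qed.

(* The invariant subspaces of a nilpotent Jordan block form a single flag. *)
Lemma shift_closed_flag n (U : {vspace 'cV[K]_n}) :
  shift_closed U -> exists2 k, (k <= n)%N & U = flag n k.
Proof.
move=> shU.
have ex_k : exists k, (fun k => (U <= flag n k)%VS) k.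
  exists n; apply/subvP => v _; apply/flagP => i; exact: coordn_out.
(* The smallest flag containing [U] will be filled from below, one dimension at a time. *)
case: (ex_minnP ex_k) => k Uk k_min.
exists k; first by apply: k_min; apply/subvP => v _; apply/flagP => i; exact: coordn_out.
apply/eqP; rewrite eqEsubv Uk /=.
suff sub m : (m <= k)%N -> (flag n m <= U)%VS by exact: sub.
elim: m => [_|m IH lt_m].
  apply/subvP => v /flagP v0; suff -> : v = 0 by exact: mem0v.
  by apply: coordn_inj => i; rewrite v0 // /coordn big1 // => j _; rewrite mxE mulr0.
(* By minimality of [k], some vector of [U] has a nonzero coordinate [k.-1], necessarily its last
   one. *)
have [w wU wk] : exists2 w, w \in U & coordn w k.-1 != 0.
  apply: contrapT => no_w; suff : (k <= k.-1)%N by lia.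
  apply: k_min; apply/subvP => w wU; apply/flagP => i.
  rewrite leq_eqVlt => /predU1P[<-|lt_i]; last first.
    by move/subvP: Uk => /(_ _ wU) /flagP; apply; lia.
  by apply/eqP; apply: contrapT => /negP wk; apply: no_w; exists w.
(* Shifting [w] brings its last nonzero coordinate to position [m]; a multiple of the result then
   cancels coordinate [m] of [u], leaving a vector of [flag n m]. *)
have [w' w'U w'E] := shift_closed_iter (k.-1 - m) shU wU.
have w'm : coordn w' m = coordn w k.-1 by rewrite w'E; congr coordn; lia.
apply/subvP => u /flagP u0.
pose a := coordn u m / coordn w' m.
rewrite -[u](subrK (a *: w')) memvD ?memvZ //.
have /subvP : (flag n m <= U)%VS by apply: IH; lia.
apply; apply/flagP => i; rewrite coordn_lin leq_eqVlt => /predU1P[<-|lt_i].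
  by rewrite /a divfK ?subrr // w'm.
rewrite u0 // w'E; move/subvP: Uk => /(_ _ wU) /flagP -> //; last lia.
by rewrite mulr0 subr0.
Qed.

End Flags.

(** * Subrepresentations as families of flags *)

Section Representation.
Variables (R : realType) (G : planar_graph) (omega : weight G) (xi : bms omega).
Let M := bms_rep R xi.
Implicit Types (U W : subrepresentation M).

(** Both cases of the definition drop the first [f_-(a)] coordinates: by [fplusE] its two
    inequalities are equivalent, and when they fail all remaining coordinates lie beyond the
    dimension. *)
Lemma coordn_bms_rep a (v : 'cV_(rep_dim M (src a))) i :
  coordn (rep_map M a *m v) i = coordn v (fminus xi a + i).
Proof.
have dE := fplusE xi a.
have entry (j : 'I_(dd xi (tgt a))) (l : 'I_(dd xi (src a))) :
    (rep_map M a : 'M_(dd xi (tgt a), dd xi (src a))) j l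
      = (l == fminus xi a + j :> nat)%N%:R.
  have lt_l := ltn_ord l; rewrite /=; case: ifP => Hif; rewrite mxE.
    by congr (_%:R); case: eqP => [lE|]; rewrite ?andbF //= andbT; lia.
  case: eqP => // lE; move/negP: Hif; case.
  have le_src : (fminus xi a <= dd xi (src a))%N.
    by rewrite ltnW // (leq_ltn_trans _ lt_l) // lE leq_addr.
  by rewrite le_src -(leq_add2r (dd xi (src a))) dE addnC leq_add2l.
case: (ltnP i (dd xi (tgt a))) => [lt_i|le_i]; last first.
  rewrite !coordn_out //=; apply: leq_trans (leq_addl (fplus xi a) _) _.
  by rewrite dE leq_add2l.
rewrite (coordn_ord _ (Ordinal lt_i)) mxE /coordn.
by apply: eq_bigr => l _; congr (_ * _); exact: entry (Ordinal lt_i) l.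
Qed.

Lemma flag_stableP (d : edge G -> nat) : (forall e, d e <= dd xi e)%N ->
  (forall a, d (src a) <= fminus xi a + d (tgt a))%N <->
  (forall a (v : 'cV_(rep_dim M (src a))), v \in flag _ _ (d (src a)) ->
     rep_map M a *m v \in flag _ _ (d (tgt a))).
Proof.
move=> d_le; split=> [d_ok a v /flagP v0|stab a].
  apply/flagP => i le_i; rewrite coordn_bms_rep v0 //.
  by apply: leq_trans (d_ok a) _; rewrite leq_add2l.
case: leqP => // lt_d.
(* The test vector is the last basis vector of the source flag; if the inequality failed, its image
   would be a basis vector outside the target flag. *)
have lt_j : ((d (src a)).-1 < rep_dim M (src a))%N by have := d_le (src a); rewrite /=; lia.
have /stab/flagP : delta_mx (Ordinal lt_j) 0 \in flag R[i] _ (d (src a)).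
  by apply/flagP => i le_i; rewrite coordn_delta ltn_eqF //=; lia.
have le_f : (fminus xi a <= (d (src a)).-1)%N by lia.
have le_i : (d (tgt a) <= (d (src a)).-1 - fminus xi a)%N by lia.
move=> /(_ _ le_i); rewrite coordn_bms_rep coordn_delta subnKC //.
by rewrite eqxx => /eqP; rewrite oner_eq0.
Qed.

(** The sum is the weight at the vertex, as [f_-] is compatible; weight 0 would make the rotation
    there a connected invisible cycle through [e]. *)
Lemma vertex_weight_one e b :
  characteristic omega -> (0 < dd xi e)%N ->
  (\sum_(a | endpoint a == endpoint (e, b)) fminus xi a = 1)%N.
Proof.
move=> omega_char d_pos; set v := endpoint (e, b).
have cyc := angles_at_cycle (inl v).
have evalE : eval omega (fun a => (a \in angles_at (inl v)) : nat)
    = weight_at omega (inl v).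
  rewrite /eval /weight_at [RHS]big_mkcond; apply: eq_bigr => a _.
  by case: (a \in _); rewrite ?mulr1 ?mulr0.
have sumE : weight_at omega (inl v)
    = (\sum_(a | endpoint a == v) fminus xi a)%N%:Z.
  rewrite -evalE -(eval_compatible (fminus_compatible xi) cyc) /eval.
  rewrite (big_morph Posz PoszD erefl) [RHS]big_mkcond; apply: eq_bigr => a _.
  by rewrite inE; case: (_ == _); rewrite ?mulr1 ?mulr0.
case: (omega_char (inl v)) => [w0|]; last by rewrite sumE => -[].
have eb : ((e, b) \in angles_at (inl v) : nat) <> 0%N by rewrite inE eqxx.
have inv : invisible omega (fun a => (a \in angles_at (inl v)) : nat).
  by split; [exists (e, b) | rewrite evalE].
move: d_pos; rewrite (bms_invisible xi cyc inv (connected_vertex (v := v))) //.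
by exists (e, b); last left.
Qed.

(** Along consecutive angles around a vertex the index shifts by [f_-] add up. *)
Lemma subspace_turn U (a : angle G) n v : v \in subspace U (src a) ->
  exists2 w, w \in subspace U (src (iter n (cw G) a)) &
    forall i, coordn w i =
      coordn v (\sum_(k < n) fminus xi (iter k (cw G) a) + i).
Proof.
move=> vU; elim: n => [|n [w wU wE]].
  by exists v => // i; rewrite big_ord0.
exists (rep_map M (iter n (cw G) a) *m w); first exact: subspace_stable wU.
by move=> i; rewrite coordn_bms_rep wE big_ord_recr /= addnA.
Qed.

(** A full turn around an end of [e] shifts the indices by the total of [f_-] there, which is 1 when
    [d(e) > 0]. *)
Lemma subspace_shift_closed U e :
  characteristic omega -> shift_closed (subspace U e).
Proof.
move=> omega_char v vU; have [d0|d_pos] := posnP (dd xi e).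
  by exists 0; [exact: mem0v | move=> i; rewrite !coordn_out //= d0].
pose a : angle G := (e, false).
have perm_inj_cw : injective (cw G) by exact: perm_inj.
have := @subspace_turn U a (order (cw G) a) v vU; rewrite iter_order //.
have -> : (\sum_(k < order (cw G) a) fminus xi (iter k (cw G) a) = 1)%N.
  rewrite -(vertex_weight_one false omega_char d_pos).
  transitivity (\sum_(b <- orbit (cw G) a) fminus xi b)%N.
    rewrite (big_nth a) size_orbit big_mkord; apply: eq_bigr => k _.
    by rewrite nth_traject.
  rewrite (big_uniq _ (orbit_uniq _ _)) /=; apply: eq_bigl => b.
  by rewrite -fconnect_orbit cw_orbit eq_sym.
by [].
Qed.

Lemma subrepresentation_ext U W :
  (forall e, subspace U e = subspace W e) -> U = W.
Proof.
move=> eqUW; case: U W eqUW => S sS [S' sS'] /= eqS.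
have eS : S = S' by exact: functional_extensionality_dep.
by subst; congr Subrepresentation; exact: Prop_irrelevance.
Qed.

Lemma subrepresentation_lattice : is_lattice (@subrepresentation_le _ G M).
Proof.
split.
- by move=> U e; exact: subvv.
- by move=> U V W UV VW e; exact: subv_trans (UV e) (VW e).
- move=> U W UW WU; apply: subrepresentation_ext => e.
  by apply: subv_anti; rewrite UW WU.
- move=> U W.
  have stab a (v : 'cV_(rep_dim M (src a))) :
      v \in (subspace U (src a) :&: subspace W (src a))%VS ->
      rep_map M a *m v \in (subspace U (tgt a) :&: subspace W (tgt a))%VS.
    by rewrite !memv_cap => /andP[vU vW]; rewrite !subspace_stable.
  exists (@Subrepresentation _ _ M (fun e => subspace U e :&: subspace W e)%VS stab).
  split=> [e|e|V VU VW e] /=; [exact: capvSl | exact: capvSr |].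
  by rewrite subv_cap VU VW.
- move=> U W.
  have stab a (v : 'cV_(rep_dim M (src a))) :
      v \in (subspace U (src a) + subspace W (src a))%VS ->
      rep_map M a *m v \in (subspace U (tgt a) + subspace W (tgt a))%VS.
    case/memv_addP => u uU [w wW ->]; rewrite mulmxDr.
    by apply: memv_add; exact: subspace_stable.
  exists (@Subrepresentation _ _ M (fun e => subspace U e + subspace W e)%VS stab).
  split=> [e|e|V UV WV e] /=; [exact: addvSl | exact: addvSr |].
  by rewrite subv_add UV WV.
Qed.

End Representation.

(** * The isomorphism of lattices *)

(** Meets and joins are pulled back along [phi], so the lattice laws need checking only for
    subrepresentations. *)
Lemma lattice_transfer (T1 T2 : Type) (le1 : T1 -> T1 -> Prop)
    (le2 : T2 -> T2 -> Prop) (phi : T1 -> T2) :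
    is_lattice le2 -> injective phi -> (forall y, exists x, phi x = y) ->
    (forall x y, le1 x y <-> le2 (phi x) (phi y)) ->
  isomorphic_lattices le1 le2.
Proof.
move=> lat2 phi_inj phi_surj phi_le.
have [psi psiK] := choice phi_surj.
split=> //; last first.
  exists phi => //; exists psi => // x.
  by apply: phi_inj; rewrite psiK.
have [rfl trs asym meet join] := lat2; split.
- by move=> x; apply/phi_le.
- by move=> x y z /phi_le xy /phi_le yz; apply/phi_le; exact: trs xy yz.
- by move=> x y /phi_le xy /phi_le yx; apply/phi_inj/asym.
- move=> x y; have [m [mx my mP]] := meet (phi x) (phi y).
  exists (psi m); split=> [||z /phi_le zx /phi_le zy]; apply/phi_le;
    rewrite psiK //; exact: mP.
- move=> x y; have [m [mx my mP]] := join (phi x) (phi y).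
  exists (psi m); split=> [||z /phi_le zx /phi_le zy]; apply/phi_le;
    rewrite psiK //; exact: mP.
Qed.

Theorem theorem5p12 (R : realType) (G : planar_graph) (omega : weight G)
    (omega_char : characteristic omega) (xi : bms omega) :
  isomorphic_lattices (@plus_subobject_le G omega xi)
    (@subrepresentation_le _ G (@bms_rep R G omega xi)).
Proof.
set M := bms_rep R xi.
have dd_le (x : plus_subobject xi) e : (dd (sval x) e <= dd xi e)%N.
  exact: bms_le_dd (svalP x) e.
have fminus_eq (x : plus_subobject xi) : fminus (sval x) = fminus xi.
  exact: bms_le_fminus (svalP x).
have stab (x : plus_subobject xi) a (v : 'cV_(rep_dim M (src a))) :
    v \in flag _ _ (dd (sval x) (src a)) ->
    rep_map M a *m v \in flag _ _ (dd (sval x) (tgt a)).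
  move: a v; apply/(flag_stableP R (dd_le x)) => a.
  by have := fplusE (sval x) a; rewrite fminus_eq; lia.
pose phi (x : plus_subobject xi) : subrepresentation M :=
  @Subrepresentation _ _ M (fun e => flag _ _ (dd (sval x) e)) (@stab x).
have phi_le x y : plus_subobject_le x y <-> subrepresentation_le (phi x) (phi y).
  split=> [le_xy e|le_xy].
    by apply/flag_leP; [exact: dd_le | exact: bms_le_dd].
  apply: bms_leP => [|e]; first by rewrite !fminus_eq.
  exact/(@flag_leP _ _ _ _ (dd_le x e))/le_xy.
apply: (lattice_transfer _ _ _ phi_le).
- exact: subrepresentation_lattice.
(* Equal images give inequalities both ways, hence equal [d]; [f_-] is common to all
   plus-subobjects. *)
- move=> x y eq_phi; have sub : sval x = sval y.
    apply: bms_ext; first by rewrite !fminus_eq.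
    have le_phi z t : phi z = phi t -> bms_le (sval z) (sval t).
      by move=> eq_zt; apply/(phi_le z t); rewrite eq_zt => e; exact: subvv.
    apply/ffunP => e; apply/eqP; rewrite eqn_leq.
    by rewrite (bms_le_dd (le_phi _ _ eq_phi)) (bms_le_dd (le_phi _ _ (esym eq_phi))).
  case: x y sub {eq_phi} => [x xP] [y yP] /= sub.
  by subst; congr exist; exact: Prop_irrelevance.
- move=> U.
  (* The dimensions of the flags making up [U] are the [d] of the state sought; stability of [U]
     makes its [f_+] nonnegative. *)
  have flagU e : exists k, (k <= dd xi e)%N /\ subspace U e = flag _ _ k.
    have [k] := shift_closed_flag (@subspace_shift_closed _ _ _ _ U e omega_char).
    by exists k.
  have [d dP] := fin_all_exists flagU.
  pose d' : {ffun edge G -> nat} := [ffun e => d e].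
  have d'_le e : (d' e <= dd xi e)%N by rewrite ffunE; have [] := dP e.
  have d'U e : subspace U e = flag _ _ (d' e) by rewrite ffunE; have [] := dP e.
  have d'_ok a : (d' (src a) <= fminus xi a + d' (tgt a))%N.
    move: a; apply/(flag_stableP R d'_le) => a v; rewrite -!d'U.
    exact: subspace_stable.
  have [zeta eqm eqd] := bms_below d'_le d'_ok.
  have zP : bms_le zeta xi by apply: bms_leP => // e; rewrite eqd.
  exists (exist _ zeta zP); apply: subrepresentation_ext => e /=.
  by rewrite eqd d'U.
Qed.
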